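(* Let $T$ be a connected topological space. If $\mathcal{F}$ is a family of subsets of $T$ such that (1) for every $S\in\mathcal{F}$, $S$ is closed, and $S$ and $\partial S$ are non-empty and connected, and (2) $\bigcup_{S\in\mathcal{S}}S\neq T$ for every finite subfamily $\mathcal{S}$ of $\mathcal{F}$, then $$\operatorname{int-asdim}(\mathcal{F})\le\operatorname{int-asdim}(\partial\mathcal{F})\le\max\{\operatorname{int-asdim}(\mathcal{F}),1\}.$$
   Context: Families are multisets. $\partial S$ is the topological boundary of $S$ in $T$, and $\partial\mathcal{F}=\{\partial X: X\in\mathcal{F}\}$ (as a family/multiset). The intersection graph of a family $\mathcal{A}$ of sets is the (finite or infinite) simple graph with vertex set $\mathcal{A}$ in which two distinct vertices (members) $S_1,S_2$ are adjacent iff $S_1\cap S_2\neq\emptyset$. For a family $\mathcal{A}$ of sets, $\operatorname{int-asdim}(\mathcal{A})$ is the asymptotic dimension of the class of the intersection graphs of all (finite or infinite) subfamilies of $\mathcal{A}$. A graph $G$ is viewed as an extended metric space (distances may be $+\infty$) $(V(G),\operatorname{dist}_G)$, where $\operatorname{dist}_G(u,v)$ is the infimum of the number of edges of paths between $u$ and $v$. In an extended metric space $(X,d)$: $\operatorname{diam}(U)=\sup_{x,y\in U}d(x,y)$; for $r>0$ a collection $\mathcal{U}$ of subsets is $r$-disjoint if $\inf_{u\in U,u'\in U'}d(u,u')>r$ for all distinct $U,U'\in\mathcal{U}$. For an integer $m\ge 0$, a function $f:\mathbb{R}_+\to\mathbb{R}_+$ is an $m$-dimensional control function for $(X,d)$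 if for every positive integer $r$ there is a cover $\mathcal{U}=\bigcup_{i=1}^{m+1}\mathcal{U}_i$ of $X$ with $\operatorname{diam}(U)\le f(r)$ for all $U\in\mathcal{U}$ and each $\mathcal{U}_i$ being $r$-disjoint. A class $\mathcal{G}$ of (finite or infinite) graphs has asymptotic dimension at most $m$ if some single function $f:\mathbb{R}_+\to\mathbb{R}_+$ is an $m$-dimensional control function for all graphs in $\mathcal{G}$; its asymptotic dimension is the least such integer $m\ge 0$ ($\infty$ if none exists). *)

(* Defs.v *)
From HB Require Import structures.
From mathcomp Require Import all_boot all_order all_algebra.
From mathcomp Require Import all_classical all_reals all_analysis.
Set Implicit Arguments.
Unset Strict Implicit.
Unset Printing Implicit Defensive.
Import Order.TTheory GRing.Theory Num.Theory.

Local Open Scope classical_set_scope.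
Local Open Scope ring_scope.

Definition boundary (T : topologicalType) (S : set T) : set T :=
  closure S `\` S°.

Record graph := Graph {
  vertex : Type;
  adj : vertex -> vertex -> Prop;
  adj_sym : forall u v, adj u v -> adj v u;
  adj_irrefl : forall u, ~ adj u u
}.

(* Only the values p 0, ..., p n matter. *)
Definition is_path (G : graph) (u v : vertex G) (n : nat)
    (p : nat -> vertex G) : Prop :=
  [/\ p 0%N = u, p n = v,
      forall k, (k < n)%N -> adj (p k) (p k.+1) &
      forall j k, (j <= n)%N -> (k <= n)%N -> p j = p k -> j = k].

Definition gdist (R : realType) (G : graph) (u v : vertex G) : \bar R :=
  ereal_inf [set (n%:R)%:E | n in [set n | exists p, is_path u v n p]].

Section ExtendedMetric.
Variables (R : realType) (X : Type) (d : X -> X -> \bar R).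

(* The diameter of the empty set is -oo, and the distance between two sets one
   of which is empty is +oo. *)
Definition diam (U : set X) : \bar R :=
  ereal_sup [set d x y | x in U & y in U].

Definition r_disjoint (r : R) (C : set (set X)) : Prop :=
  forall U U', C U -> C U' -> U <> U' ->
    (r%:E < ereal_inf [set d x y | x in U & y in U'])%E.

Definition control_function (m : nat) (f : {nonneg R} -> {nonneg R}) : Prop :=
  forall r : nat, (0 < r)%N ->
    exists C : 'I_m.+1 -> set (set X),
      [/\ forall x, exists i U, C i U /\ U x,
          forall i U, C i U -> (diam U <= ((f (r%:R)%:nng)%:num)%:E)%E &
          forall i, r_disjoint r%:R (C i)].

End ExtendedMetric.

(* Classes of graphs are plain predicates: set graph would be a universe
   inconsistency, as set_type must be allowed as a type of vertices. *)
Definition asdim_le (R : realType) (C : graph -> Prop) (m : nat) : Prop :=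
  exists f : {nonneg R} -> {nonneg R},
    forall G, C G -> control_function (@gdist R G) m f.

Definition asdim (R : realType) (C : graph -> Prop) : \bar R :=
  ereal_inf [set (m%:R)%:E | m in [set m | asdim_le R C m]].

(* A family (multiset) of subsets of T is an indexed family A : I -> set T: the
   members are the indices, so that repeated sets are distinct vertices. *)
Section IntersectionGraph.
Variables (T I : Type) (A : I -> set T).

Definition int_adj (i j : I) : Prop := i <> j /\ A i `&` A j !=set0.

Lemma int_adj_sym i j : int_adj i j -> int_adj j i.
Proof. by move=> [ij Aij]; split; [exact: nesym | rewrite setIC]. Qed.

Lemma int_adj_irrefl i : ~ int_adj i i.
Proof. by case. Qed.

Definition int_graph : graph := Graph int_adj_sym int_adj_irrefl.

End IntersectionGraph.

Definition subfamily (T I : Type) (A : I -> set T) (J : set I) : J -> set T :=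
  fun j => A (val j).

Definition int_asdim (R : realType) (T I : Type) (A : I -> set T) : \bar R :=
  asdim R (fun G => exists J : set I, G = int_graph (@subfamily T I A J)).

(* Main.v *)
Require Import Defs.
From mathcomp Require Import all_boot all_order all_algebra.
From mathcomp Require Import all_classical all_reals all_analysis.
From mathcomp Require Import zify.

Import Order.TTheory GRing.Theory Num.Theory.

Local Open Scope classical_set_scope.

(** Call x nested in y when x lies in the interior of y.  By connectedness and
    (2), two members that meet have meeting boundaries or are nested.  Being of
    asymptotic dimension at most m means that, for each r, the vertices can be
    (m+1)-coloured so that monochromatic r-chains have bounded extent, and by
    compactness it is enough to colour finite subfamilies uniformly.  In a
    finite subfamily, sending a member to a maximal member above it is a
    1-Lipschitz retraction onto an antichain, where the two graphs agree; this
    gives the first inequality.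

    For the second one, the boundary graph is tree-like: once the maximal
    members and their neighbours are removed, each remaining component hangs
    below a single maximal member.  So one colours the maximal members, extends
    each colour c down to distance L, puts another colour on the annulus from L
    to 2L as a barrier, and recurses beyond the barrier.  A monochromatic chain
    then stays between two consecutive barriers, and two colours suffice to
    build barriers, whence the maximum with 1. *)

(** * Bounded reachability and colourings with bounded monochromatic chains *)

Fixpoint reach {V : Type} (E : V -> V -> Prop) (n : nat) (x y : V) : Prop :=
  if n is k.+1 then exists2 z, x = z \/ E x z & reach E k z y else x = y.

(** Vertices outside [A] remain as isolated points, so all subfamilies share one vertex type. *)
Definition restr {V : Type} (A : set V) (E : V -> V -> Prop) (x y : V) : Prop :=
  [/\ A x, A y & E x y].

Definition mono_step {V C : Type} (E : V -> V -> Prop) (r : nat) (c : V -> C)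
    (x y : V) : Prop :=
  c x = c y /\ reach E r x y.

(** A step of [reach] may stay put, so [reach E D] is a distance bound; [D] does not depend on the
    length [n] of the chain. *)
Definition colorable {V : Type} (C : Type) (E : V -> V -> Prop) (r D : nat) :=
  exists c : V -> C, forall n x y,
    reach (mono_step E r c) n x y -> reach E D x y.

Section Reach.
Context {V : Type}.
Implicit Types (E : V -> V -> Prop) (A : set V).

Lemma reach_refl E n x : reach E n x x.
Proof. by elim: n => //= n IHn; exists x => //; left. Qed.

Lemma reach1 E x y : E x y -> reach E 1 x y.
Proof. by move=> Exy; exists y => //; right. Qed.

Lemma reach_trans E m n x y z :
  reach E m x y -> reach E n y z -> reach E (m + n) x z.
Proof.
elim: m x => [|m IHm] x /=; first by move->.
by move=> [u xu uy] yz; exists u => //; exact: IHm.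
Qed.

Lemma reach_leq E m n x y : (m <= n)%N -> reach E m x y -> reach E n x y.
Proof.
move=> /subnKC <- xy; apply: reach_trans xy _; exact: reach_refl.
Qed.

Lemma reach_sym E (Esym : forall x y, E x y -> E y x) n x y :
  reach E n x y -> reach E n y x.
Proof.
elim: n x => [|n IHn] x; first by move=> /= ->.
move=> [z xz /IHn yz]; rewrite -addn1; apply: reach_trans yz _.
by exists x => //; case: xz => [->|/Esym]; [left|right].
Qed.

Lemma reach_map {W : Type} (h : V -> W) E (E' : W -> W -> Prop) :
  (forall x y, E x y -> h x = h y \/ E' (h x) (h y)) ->
  forall n x y, reach E n x y -> reach E' n (h x) (h y).
Proof.
move=> hE; elim=> [|n IHn] x y /=; first by move->.
by move=> [z xz /IHn zy]; exists (h z) => //; case: xz => [->|/hE]; [left|].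
Qed.

Lemma reach_sub E E' : (forall x y, E x y -> E' x y) ->
  forall n x y, reach E n x y -> reach E' n x y.
Proof. by move=> EE'; apply: (@reach_map _ id) => x y /EE'; right. Qed.

Lemma reach_restr A E n x y : reach (restr A E) n x y -> x = y \/ A x /\ A y.
Proof.
elim: n x => [|n IHn] x /=; first by left.
by move=> [z [-> /IHn//|[Ax Az _]] /IHn [<-|[_ Ay]]]; right.
Qed.

Lemma restr_sym A E : (forall x y, E x y -> E y x) ->
  forall x y, restr A E x y -> restr A E y x.
Proof. by move=> Esym x y [Ax Ay /Esym]. Qed.

Lemma mono_step_sym {C : Type} E r (c : V -> C) :
  (forall x y, E x y -> E y x) ->
  forall x y, mono_step E r c x y -> mono_step E r c y x.
Proof. by move=> Esym x y [cxy xy]; split=> //; exact: reach_sym. Qed.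

Lemma sub_colorable (C C' : Type) (g : C -> C') E r D :
  injective g -> colorable C E r D -> colorable C' E r D.
Proof.
move=> ginj [c cP]; exists (g \o c) => n x y xy; apply: (cP n).
by apply: reach_sub xy => u v [/ginj].
Qed.

(* The finite colourings are glued along an ultrafilter on the finite lists of
   vertices: a monochromatic chain of the limit colouring is finite, hence is
   monochromatic for almost all of them. *)
Lemma colorable_compact (C : finType) E r D :
  (forall l : seq V, colorable C (restr (fun x => List.In x l) E) r D) ->
  colorable C E r D.
Proof.
move=> /choice[c cP].
pose lists := [set P : set (seq V) | exists l0, forall l,
  (forall x, List.In x l0 -> List.In x l) -> P l].
have listsF : ProperFilter lists.
  split; first by move=> [l0 /(_ l0)]; apply.
  split; first by exists [::].
    move=> P Q [l1 Pl1] [l2 Ql2]; exists (l1 ++ l2) => l l12.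
    by split; [apply: Pl1 | apply: Ql2] => x xl; apply: l12;
      apply/List.in_or_app; [left|right].
  by move=> P Q PQ [l0 Pl0]; exists l0 => l /Pl0 /PQ.
have [U [Uultra listsU]] := ultraFilterLemma listsF.
have UF : ProperFilter U by apply: ultra_proper.
have inU x : U [set l | List.In x l].
  by apply: listsU; exists [:: x] => l; apply; left.
have reachU n x y : reach E n x y ->
    U [set l | reach (restr (fun x => List.In x l) E) n x y].
  elim: n x => [|n IHn] x /=.
    by move=> ->; apply: filterS filterT => l _.
  move=> [z [<-|xz] zy].
    by apply: filterS (IHn _ zy) => l xy; exists x => //; left.
  apply: filterS (filterI (IHn _ zy) (filterI (inU x) (inU z))).
  by move=> l [zyl [xl zl]]; exists z => //; right.
have /choice[k kP] : forall x, exists i, U [set l | c l x = i].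
  move=> x; apply: contrapT => /forallNP noi.
  have : U [set l | forall i, c l x <> i].
    apply: filter_forall => i.
    by have [/noi|] := in_ultra_setVsetC [set l | c l x = i] Uultra.
  by move=> /filter_ex[l /(_ (c l x))].
exists k => n x y xy.
have : U [set l | reach (mono_step (restr (fun x => List.In x l) E) r (c l))
                    n x y].
  elim: n x xy => [|n IHn] x /=.
    by move=> ->; apply: filterS filterT => l _.
  move=> [z [<-|[kxz xz]] zy].
    by apply: filterS (IHn _ zy) => l xy; exists x => //; left.
  apply: filterS (filterI (IHn _ zy) (filterI (reachU _ _ _ xz)
    (filterI (kP x) (kP z)))).
  move=> l [zyl [xzl [cx cz]]]; exists z => //; right; split=> //.
  by rewrite cx cz.
move=> /filter_ex[l /cP]; apply: reach_sub => u v []//.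
Qed.

End Reach.

(** * From control functions on a graph to colourings and back *)

Section GraphDistance.
Context (R : realType) (G : graph).
Local Open Scope ring_scope.
Local Open Scope ereal_scope.

Lemma path_reach (u v : vertex G) n p :
  is_path u v n p -> reach (@adj G) n u v.
Proof.
move=> [<- <- adjp _].
have : forall k, (k <= n)%N -> reach (@adj G) k (p 0%N) (p k).
  elim=> [//|k IHk] kn; rewrite -addn1.
  apply: reach_trans (IHk (ltnW kn)) _.
  by rewrite addn1; apply: reach1; exact: adjp.
exact.
Qed.

(** A walk of minimal length repeats no vertex, since a repetition could be cut out. *)
Lemma reach_path (u v : vertex G) n : reach (@adj G) n u v ->
  exists2 k, (k <= n)%N & exists p, is_path u v k p.
Proof.
move=> uvn.
have ex : exists k, `[< reach (@adj G) k u v >] by exists n; exact/asboolP.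
case: (ex_minnP ex) => k /asboolP uvk kmin.
exists k; first by apply: kmin; apply/asboolP.
have [p [p0 pk padj]] : exists p : nat -> vertex G, [/\ p 0%N = u, p k = v &
    forall i, (i < k)%N -> p i = p i.+1 \/ adj (p i) (p i.+1)].
  elim: k u uvk {ex kmin uvn} => [|k IHk] u /=.
    by move=> <-; exists (fun=> u).
  move=> [w uw /IHk [p [p0 pk padj]]].
  exists (fun i => if i is i'.+1 then p i' else u); split=> // -[|i] ik.
    by rewrite p0.
  exact: padj.
have pre i j : (i <= j <= k)%N -> reach (@adj G) (j - i) (p i) (p j).
  elim: j => [|j IHj].
    by rewrite leqn0 => /andP[/eqP -> _].
  case: (ltngtP i j.+1) => // [ij|-> _]; last by rewrite subnn.
  move=> /= jk; rewrite subSn// -addn1; apply: (reach_trans _ _ _ _ (p j)).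
    by apply: IHj; lia.
  by exists (p j.+1) => //; apply: padj; lia.
have inj i j : (i < j <= k)%N -> p i <> p j.
  move=> ijk pij.
  have : reach (@adj G) (i + (k - j)) u v.
    rewrite -p0 -pk; apply: reach_trans (pre j k _); last by lia.
    by rewrite -pij -[i in reach _ i](subn0 i); apply: pre; lia.
  by move=> /asboolP /kmin; lia.
exists p; split=> //.
  move=> i ik; case: (padj i ik) => // /inj; case; lia.
move=> i j ik jk pij; case: (ltngtP i j) => // ij.
  by case: (inj i j) => //; lia.
by case: (inj j i) => //; lia.
Qed.

Lemma lt_gdist (u v : vertex G) n :
  ~ reach (@adj G) n u v -> n.+1%:R%:E <= gdist R u v.
Proof.
move=> nuv; apply: le_ereal_inf_tmp => _ [k [p /path_reach uvk] <-].
rewrite lee_fin ler_nat ltnNge; apply/negP => kn; apply: nuv.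
exact: reach_leq uvk.
Qed.

Lemma gdist_leP (u v : vertex G) n :
  gdist R u v <= n%:R%:E <-> reach (@adj G) n u v.
Proof.
split=> [uvn|/reach_path[k kn kp]]; last first.
  apply: (@le_trans _ _ k%:R%:E); last by rewrite lee_fin ler_nat.
  by apply: ereal_inf_lbound; exists k.
apply: contrapT => /lt_gdist /le_trans /(_ uvn).
by rewrite lee_fin ler_nat ltnn.
Qed.

(** Choose for each point a set of the cover containing it. By disjointness an [r]-step within one
    colour keeps the chosen set, so a whole chain lies in a set of bounded diameter. *)
Lemma control_colorable (m r D : nat) (f : {nonneg R} -> {nonneg R}) :
  (0 < r)%N -> ((f (r%:R)%:nng)%:num <= D%:R)%R ->
  control_function (@gdist R G) m f -> colorable 'I_m.+1 (@adj G) r D.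
Proof.
move=> r0 fD /(_ r r0)[C [Ccov Cdiam Cdisj]].
have /choice[c /choice[U cU]] := Ccov.
exists c => n x y xy; apply/gdist_leP.
have Uxy : U x = U y.
  elim: n x xy => [|n IHn] x /=; first by move->.
  move=> [z [->|[cxz /gdist_leP xz]] /IHn <-] //.
  apply: contrapT => Uxz; have [CUx Ux] := cU x; have [CUz Uz] := cU z.
  rewrite -cxz in CUz; have := Cdisj _ _ _ CUx CUz Uxz.
  rewrite ltNge => /negP; apply; apply: le_trans xz.
  by apply: ereal_inf_lbound; exists x => //; exists z.
apply: (@le_trans _ _ (diam (@gdist R G) (U x))).
  apply: ereal_sup_ubound; exists x; first by have [] := cU x.
  by exists y => //; rewrite Uxy; have [] := cU y.
by apply: le_trans (Cdiam _ _ (cU x).1) _; rewrite lee_fin.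
Qed.

(** The cover consists of the classes of the monochromatic [r]-chain relation. *)
Lemma colorable_control (m : nat) (D : nat -> nat) :
  (forall r, (0 < r)%N -> colorable 'I_m.+1 (@adj G) r (D r)) ->
  control_function (@gdist R G) m
    (fun x => ((D (Num.truncn x%:num))%:R)%:nng%R).
Proof.
move=> Dcol r r0; have [c cP] := Dcol r r0.
have sym := mono_step_sym (@adj G) r c (@adj_sym G).
pose cls x := [set y | exists n, reach (mono_step (@adj G) r c) n x y].
exists (fun i => [set U | exists2 x, c x = i & U = cls x]); split.
- move=> x; exists (c x), (cls x); split; first by exists x.
  by exists 0%N.
- move=> i U [x _ ->]; rewrite /= natrK.
  apply: ge_ereal_sup => _ [y [k xy] [z [l xz] <-]]; apply/gdist_leP.
  apply: (cP (k + l)%N); apply: reach_trans xz.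
  exact: reach_sym.
- move=> i U U' [x cx ->] [y cy ->] xy.
  (* Distances are integers or infinite, so exceeding [r] means being at least [r.+1]; this makes
     the infimum strictly larger than [r]. *)
  apply: (@lt_le_trans _ _ r.+1%:R%:E); first by rewrite lte_fin ltr_nat.
  apply: le_ereal_inf_tmp => _ [u [k xu] [v [l yv] <-]]; apply: lt_gdist => uv.
  have cc n a b : reach (mono_step (@adj G) r c) n a b -> c a = c b.
    by elim: n a => [a ->//|n IHn] a /= [d [->|[-> _]] /IHn].
  have xy' : reach (mono_step (@adj G) r c) (k + (1 + l)) x y.
    apply: reach_trans (xu) _; apply: (reach_trans _ _ _ _ v).
      by apply: reach1; split=> //; rewrite -(cc _ _ _ xu) -(cc _ _ _ yv) cx cy.
    exact: reach_sym.
  apply: xy; apply/seteqP; split=> z [n h].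
    exists (k + (1 + l) + n)%N; apply: reach_trans h.
    exact: reach_sym.
  by exists (k + (1 + l) + n)%N; apply: reach_trans h.
Qed.

End GraphDistance.

(** * Asymptotic dimension of a family in terms of colourings *)

Section IntAsdim.
Context (R : realType) {T I : Type} (A : I -> set T).
Local Open Scope ring_scope.

Lemma colorable_subfamily (C : Type) (c0 : C) (J : set I) r D :
  colorable C (@adj (int_graph (@subfamily T I A J))) r D <->
  colorable C (restr J (int_adj A)) r D.
Proof.
have inJ (u : J) : J (val u) by case: u => x /= /set_mem.
have valE n (u v : J) :
    reach (@adj (int_graph (@subfamily T I A J))) n u v <->
    reach (restr J (int_adj A)) n (val u) (val v).
  split; first apply: (@reach_map _ _ val).
    move=> x y /= [xy Axy]; right; split; [exact: inJ | exact: inJ |].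
    by split=> // /val_inj.
  elim: n u => [|n IHn] u /=; first exact: val_inj.
  move=> [z [uz|[_ Jz [uz Auz]]]].
    by rewrite -uz => /IHn; exists u => //; left.
  move=> zv; exists (SigSub (mem_set Jz)); last exact: IHn.
  by right; split => // uz'; apply: uz; rewrite uz'.
split=> [[c cP]|[c cP]].
  (* The default colour [c0] is harmless: a chain starting outside [J] cannot move. *)
  pose c' x := if pselect (J x) is left Jx then c (SigSub (mem_set Jx)) else c0.
  have c'E (u : J) : c' (val u) = c u.
    rewrite /c'; case: pselect => [Ju|]; last by case; exact: inJ.
    by congr c; exact: val_inj.
  exists c' => n x y xy.
  have [Jx|nJx] := pselect (J x); last first.
    suff -> : x = y by exact: reach_refl.
    elim: n x xy nJx => [//|n IHn] x /= [z xz zy] nJx.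
    have xz' : x = z.
      by case: xz => // -[_ xz]; case: (reach_restr _ _ _ _ _ xz) => // -[].
    by rewrite xz' in nJx *; exact: IHn.
  have [v vy xv] : exists2 v : J, val v = y &
      reach (mono_step (@adj (int_graph (@subfamily T I A J))) r c) n
        (SigSub (mem_set Jx)) v.
    elim: n x xy Jx => [|n IHn] x /=.
      by move=> -> Jy; exists (SigSub (mem_set Jy)).
    move=> [z xz zy] Jx.
    have Jz : J z.
      case: (xz) => [<-//|[_ xz']].
      by case: (reach_restr _ _ _ _ _ xz') => [<-|[]].
    have [v vy zv] := IHn _ zy Jz; exists v => //.
    exists (SigSub (mem_set Jz)) => //.
    case: xz => [xz|[cxz xz]]; [left; exact: val_inj|right].
    by split; [rewrite -!c'E | apply/valE].
  by rewrite -vy; apply/(valE _ (SigSub (mem_set Jx)))/(cP n).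
exists (c \o val) => n x y xy; apply/valE/(cP n).
apply: reach_map xy => u v [cuv uv]; right; split=> //; exact/valE.
Qed.

(** One [D] serves all [J], as one control function must serve the whole class. *)
Lemma asdim_le_colorable (m : nat) :
  asdim_le R (fun G => exists J : set I, G = int_graph (@subfamily T I A J)) m
  <-> forall r, (0 < r)%N ->
        exists D, forall J, colorable 'I_m.+1 (restr J (int_adj A)) r D.
Proof.
split=> [[f fP] r r0|].
  exists (Num.truncn (f (r%:R)%:nng)%:num).+1 => J.
  apply/(colorable_subfamily _ ord0)/(control_colorable R _ _ _ _ f) => //.
    by apply/ltW/truncnS_gt.
  by apply: fP; exists J.
move=> col.
have /choice[D DP] : forall r, exists D, (0 < r)%N -> forall J,
    colorable 'I_m.+1 (restr J (int_adj A)) r D.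
  move=> [|r]; first by exists 0%N.
  by have [D DP] := col r.+1 isT; exists D.
exists (fun x => ((D (Num.truncn x%:num))%:R)%:nng) => _ [J ->].
apply: colorable_control => r r0; apply/(colorable_subfamily _ ord0).
exact: DP.
Qed.

End IntAsdim.

(** * Finite families ordered by nesting *)

Definition listed {V : Type} (A : set V) :=
  exists l : seq V, forall x, A x -> List.In x l.

(** Induction on the length of an enumerating list: a subset missing [s] is enumerated after
    deleting an occurrence of [s]. *)
Lemma listed_ind {V : Type} (P : set V -> Prop) :
  (forall A, listed A ->
     (forall B s, B `<=` A -> A s -> ~ B s -> P B) -> P A) ->
  forall A, listed A -> P A.
Proof.
move=> step A [l Al]; move: {2}(size l) (leqnn (size l)) => n.
elim: n l A Al => [|n IHn] l A Al ln.
  apply: step; first by exists l.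
  by move=> B s _ /Al; case: l ln {Al}.
apply: step => [|B s BA As nBs]; first by exists l.
have [l1 [l2 lE]] := List.in_split _ _ (Al _ As).
apply: (IHn (l1 ++ l2)).
  move=> x Bx; have := Al _ (BA _ Bx); rewrite lE => /List.in_app_iff xl.
  apply/List.in_app_iff; case: xl => [|[sx|]]; [by left| |by right].
  by case: nBs; rewrite sx.
by move: ln; rewrite lE !size_cat /= addnS.
Qed.

(* [a] is intersection of members, [b] intersection of their boundaries, and
   [lt x y] means that [x] lies in the interior of [y]. *)
Record nesting {I : Type} (a b lt : I -> I -> Prop) : Prop := Nesting {
  meet_sym : forall x y, a x y -> a y x;
  bmeet_sym : forall x y, b x y -> b y x;
  bmeet_meet : forall x y, b x y -> a x y;
  nest_meet : forall x y, lt x y -> a x y;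
  nest_trans : forall x y z, lt x y -> lt y z -> lt x z;
  nest_irrefl : forall x, ~ lt x x;
  bmeet_nest : forall x y, b x y -> ~ lt x y;
  nest_meetW : forall x y z, lt x y -> a x z -> y = z \/ a y z;
  meet_cases : forall x y, a x y -> [\/ b x y, lt x y | lt y x]
}.

Arguments meet_sym {I a b lt} _ [x y] _.
Arguments bmeet_sym {I a b lt} _ [x y] _.
Arguments bmeet_meet {I a b lt} _ [x y] _.
Arguments nest_meet {I a b lt} _ [x y] _.
Arguments nest_trans {I a b lt} _ [x y z] _ _.
Arguments nest_irrefl {I a b lt} _ [x] _.
Arguments bmeet_nest {I a b lt} _ [x y] _ _.
Arguments nest_meetW {I a b lt} _ [x y z] _ _.
Arguments meet_cases {I a b lt} _ [x y] _.

Section Nesting.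
Context {I : Type} {a b lt : I -> I -> Prop} (N : nesting a b lt).
Implicit Types A M : set I.

(** The remaining case, [t] nested in [z], would nest [x] in [z] although their boundaries meet. *)
Lemma nest_bmeet x t z : lt x t -> b x z -> [\/ z = t, b z t | lt z t].
Proof.
move=> xt xz; have /(nest_meetW N)/(_ (bmeet_meet N xz)) := xt.
case=> [->|/(meet_cases N)[tz|tz|zt]]; first by constructor 1.
- by constructor 2; exact: (bmeet_sym N tz).
- by case: (bmeet_nest N xz); exact: (nest_trans N xt tz).
- by constructor 3.
Qed.

(** This makes passing to a larger member a 1-Lipschitz map for [a]. *)
Lemma meet_above x y s t : x = s \/ lt x s -> y = t \/ lt y t -> a x y ->
  s = t \/ a s t.
Proof.
move=> xs yt xy.
have : s = y \/ a s y.
  by case: xs => [<-|xs]; [right | exact: (nest_meetW N xs xy)].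
case=> [sy|sy]; last first.
  case: yt => [<-|yt]; first by right.
  case: (nest_meetW N yt (meet_sym N sy)) => [->|ts]; first by left.
  by right; exact: (meet_sym N ts).
rewrite sy; case: yt => [->|yt]; first by left.
by right; exact: (nest_meet N yt).
Qed.

Definition maxl A := [set x | A x /\ forall y, A y -> ~ lt x y].

Lemma maxl_meet A x y : maxl A x -> maxl A y -> a x y -> b x y.
Proof.
move=> [Ax xmax] [Ay ymax] /(meet_cases N)[//|xy|yx].
  by case: (xmax _ Ay).
by case: (ymax _ Ax).
Qed.

Lemma maxl_ex A : listed A ->
  forall x, A x -> exists t, maxl A t /\ (x = t \/ lt x t).
Proof.
move: A; apply: listed_ind => A Al IH x Ax.
have [xmax|/existsNP[y /not_implyP[Ay /contrapT xy]]] :=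
    pselect (forall y, A y -> ~ lt x y).
  by exists x; split; [|left].
have [||||t [[[At xt] tmax] yt]] := IH [set z | A z /\ lt x z] x _ _ _ y => //.
- by move=> z [].
- by move=> [_ /(nest_irrefl N)].
exists t; split; last by right.
split=> // z Az tz; apply: (tmax z) => //; split=> //.
exact: (nest_trans N xt tz).
Qed.

(* Away from the maximal members, the members that nest a given one do not
   change along an edge of [b]; choosing [rho] as a function of that set makes
   it constant there. *)
Lemma dominator A : listed A -> exists rho : I -> I,
  [/\ forall x, A x -> maxl A (rho x) /\ (x = rho x \/ lt x (rho x)),
      forall x, ~ A x -> rho x = x &
      forall x y, A x -> A y -> ~ maxl A x -> ~ maxl A y ->
        (forall t, maxl A t -> lt x t <-> lt y t) -> rho x = rho y].
Proof.
move=> Al.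
have [[x0 _]|noI] := pselect (exists x : I, True); last first.
  exists id; split=> // x; by case: noI; exists x.
have /choice[g gP] : forall P : set I, exists t, P !=set0 -> P t.
  by move=> P; have [[t Pt]|nP] := pselect (P !=set0); [exists t|exists x0].
pose up x := [set t | maxl A t /\ lt x t].
exists (fun x => if pselect (A x /\ ~ maxl A x) then g (up x) else x).
split=> [x Ax|x nAx|x y Ax Ay nx ny xy].
- case: pselect => [[Ax' nx]|h] /=; last first.
    by split; [apply: contrapT => nx; apply: h | left].
  have [t [tmax [xt|xt]]] := maxl_ex _ Al _ Ax; first by case: nx; rewrite xt.
  have [] : up x (g (up x)) by apply: gP; exists t.
  by move=> gmax xg; split; [|right].
- by case: pselect => // -[].
- case: pselect => [h1|[]//] /=; case: pselect => [h2|[]//] /=; congr g.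
  by apply/seteqP; split=> t [tmax h]; split=> //; apply/xy.
Qed.

(* Domination by the maximal members retracts the graph of [a] onto a subgraph
   where [a] and [b] agree. *)
Lemma colorable_nest_meet (C : Type) r D A : listed A ->
  (forall M, colorable C (restr M b) r D) ->
  colorable C (restr A a) r (D + 2).
Proof.
move=> Al /(_ (maxl A))[c cP]; have [rho [rhoA rhoNA _]] := dominator _ Al.
have rhob x y : restr A a x y ->
    rho x = rho y \/ restr (maxl A) b (rho x) (rho y).
  move=> [Ax Ay xy].
  have [mx xrx] := rhoA _ Ax; have [my yry] := rhoA _ Ay.
  have [->|rxy] := meet_above _ _ _ _ xrx yry xy; [by left|right].
  by split=> //; exact: (maxl_meet _ _ _ mx my rxy).
have rho1 x : reach (restr A a) 1 x (rho x).
  have [Ax|/rhoNA ->] := pselect (A x); last exact: reach_refl.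
  have [[Arx _] [<-|xrx]] := rhoA _ Ax; first exact: reach_refl.
  by apply: reach1; split=> //; exact: (nest_meet N xrx).
exists (c \o rho) => n x y xy.
(* The extra 2 pays for moving each end of the chain to its image under [rho]. *)
rewrite addn2 -addn1 -add1n; apply: reach_trans (rho1 x) _.
apply: reach_trans (reach_sym _ (restr_sym _ _ (meet_sym N)) _ _ _ (rho1 y)).
have : reach (restr (maxl A) b) D (rho x) (rho y).
  apply: (cP n); apply: reach_map xy => u v [cuv uv]; right.
  by split=> //; exact: reach_map uv.
by apply: reach_sub => u v [[Au _] [Av _] /(bmeet_meet N)].
Qed.

End Nesting.

(** * Recursive colouring of the boundary graph *)

Section WeightedColoring.
Context {I C : Type} {a b lt : I -> I -> Prop} (N : nesting a b lt).
Implicit Types (A B M : set I) (W : nat -> set I).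

(** A path leaving the inside of [t] must pass through [t] or a [b]-neighbour of [t]; from there [t]
    replaces the part of the path already covered. *)
Lemma nest_escape A n x t s : A t -> lt x t -> ~ lt s t ->
  reach (restr A b) n x s ->
  reach (restr A b) n t s /\ reach (restr A b) n.+1 x t.
Proof.
move=> At + st; elim: n x => [|n IHn] x xt;
  first by move=> /= xs; case: st; rewrite -xs.
move=> [z xz zs].
have IHz : lt z t -> reach (restr A b) n.+1 t s /\ reach (restr A b) n.+2 x t.
  move=> /IHn/(_ zs)[ts zt]; split; first by apply: reach_leq ts.
  by exists z.
case: xz => [xz|[Ax Az xz]]; first by apply: IHz; rewrite -xz.
case: (nest_bmeet N _ _ _ xt xz) => [zt|zt|//].
- rewrite -zt; split; first by apply: reach_leq zs.
  by apply: (@reach_leq _ _ 1) => //; apply: reach1.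
- split; first by exists z => //; right; split=> //; exact: (bmeet_sym N).
  apply: (@reach_leq _ _ 2) => //; exists z; first by right.
  exact: reach1.
Qed.

(* [W n x] reads: the weight of [x] is at most [n]. *)
Definition weight A W :=
  [/\ forall n x, W n x -> W n.+1 x,
      forall n x y, restr A b x y -> W n x -> W n.+1 y &
      forall n x y, A x -> A y -> lt x y -> W n x -> W n y].

Lemma weight_leq A W m n x : weight A W -> (m <= n)%N -> W m x -> W n x.
Proof.
move=> [W1 _ _] /subnK <- Wx; elim: (n - m)%N => // k; exact: W1.
Qed.

Lemma weight_reach A W k n x y : weight A W ->
  reach (restr A b) k x y -> W n x -> W (n + k)%N y.
Proof.
move=> wW; have [W1 Wb _] := wW; elim: k n x => [|k IHk] n x /=.
  by move=> ->; rewrite addn0.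
move=> [z [<-|xz] zy] Wx; rewrite -addSnnS; apply: IHk zy _; first exact: W1.
exact: Wb Wx.
Qed.

Definition dist_le A M n := [set x | exists2 s, M s & reach (restr A b) n x s].

(** Monotonicity under nesting is [nest_escape]: a path from inside [y] to [M] has to leave [y]. *)
Lemma weight_dist A B M : B `<=` A -> (forall s t, M s -> B t -> ~ lt s t) ->
  weight B (dist_le A M).
Proof.
move=> BA MB; split=> [n x [s Ms xs]|n x y [Bx By xy] [s Ms xs]|].
- by exists s => //; exact: reach_leq xs.
- exists s => //; exists x => //; right.
  by split; [exact: BA|exact: BA|exact: (bmeet_sym N)].
- move=> n x y Bx By xy [s Ms xs]; exists s => //.
  by have [] := nest_escape _ _ _ _ _ (BA _ By) xy (MB _ _ Ms By) xs.
Qed.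

Context {alt : C -> C} {r L Df D0 D1 D : nat}.
Context (altP : forall i, alt i <> i).
Context (meet_colorable : forall M, colorable C (restr M a) r Df).
(** [L] is so large that an [r]-step can neither jump over a barrier nor change dominator beyond
    depth [L]. [D0] adds to [Df] the way from both ends to their dominators, [D1] adds the weight
    [2 * L + r] and one more [r]-step, and [D] joins two points within [D1] of [M] through their
    common dominator. *)
Context (rL : (r + 3 <= L)%N) (D0P : (Df + 2 * L.+1 <= D0)%N).
Context (D1P : (2 * L + 2 * r + D0 <= D1)%N) (DP : (2 * D1.+1 <= D)%N).

(** Members of weight at most [L] carry the inherited colour, and their chains are bounded one level
    up. *)
Definition outer_step A W (c : I -> C) x y :=
  [/\ A x, A y, ~ W L x, ~ W L y & mono_step (restr A b) r c x y].

Lemma outer_step_sym A W c x y : outer_step A W c x y -> outer_step A W c y x.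
Proof.
move=> [Ax Ay Wx Wy xy]; split=> //; apply: mono_step_sym xy.
exact: restr_sym _ _ (bmeet_sym N).
Qed.

(* The weight is the distance to the part of the family coloured earlier:
   [i] is the colour of the point where [A] hangs, and chains that come close
   to it are bounded through their weights rather than by paths inside [A].
   Keeping [D1] independent of [D] makes the bounds survive the recursion. *)
Definition weighted_coloring A W i (c : I -> C) :=
  [/\ forall x, A x -> W L x -> c x = i,
      forall x, A x -> ~ W L x -> W (2 * L)%N x -> c x = alt i &
      forall n x y, A x -> reach (outer_step A W c) n x y ->
        reach (restr A b) D x y \/ W D1 x /\ W D1 y].

(** Induction on [A]. The maximal members [M] of the part [A'] of weight above [2 * L] are coloured
    by [cM]. Members of [A'] farther than 2 from [M] split into families [B s] dominated by [s];
    each omits [s], so it is coloured recursively with weight [E], the distance to [M], and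
    inherited colour [cM s]. *)
Lemma weighted_coloring_ex A : listed A -> forall W i, weight A W ->
  exists c, weighted_coloring A W i c.
Proof.
move: A; apply: listed_ind => A Al IH W i wW.
have bsym := restr_sym A b (bmeet_sym N).
have Wleq m n x := weight_leq A W m n x wW.
have Wreach k n x y := weight_reach A W k n x y wW.
pose A' := [set x | A x /\ ~ W (2 * L)%N x].
have A'A : A' `<=` A by move=> x [].
have A'l : listed A' by have [l lP] := Al; exists l => x /A'A /lP.
pose M := maxl (lt:=lt) A'; pose E := dist_le A M.
have MA' s : M s -> A' s by case.
have Mmax s t : M s -> A' t -> ~ lt s t by move=> [_ h] /h.
have wE : weight A' E by apply: weight_dist A'A _.
have Eleq m n x := weight_leq A' E m n x wE.
have Ereach k n x y : reach (restr A b) k x y -> E n x -> E (n + k)%N y.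
  move=> xy [s Ms xs]; exists s => //; rewrite addnC.
  by apply: reach_trans (xs); exact: reach_sym.
have [rho [rhoA' _ rhoE]] := dominator N _ A'l.
have E_rho n x : A' x -> E n x -> reach (restr A b) n.+1 x (rho x).
  move=> A'x [s Ms xs]; have [Mx [<-|xrx]] := rhoA' _ A'x.
    exact: reach_refl.
  have Ax := A'A _ (MA' _ Mx).
  by have [] := nest_escape _ _ _ _ _ Ax xrx (Mmax _ _ Ms (MA' _ Mx)) xs.
have nEnM x : ~ E 2 x -> ~ M x.
  by move=> nE Mx; apply: nE; exists x => //; exact: reach_refl.
have below x : A' x -> ~ E 2 x -> lt x (rho x).
  move=> A'x nE; have [Mx [xr|//]] := rhoA' _ A'x.
  by case: (nEnM _ nE); rewrite xr.
(* The neighbour [y] is nested in [rho x], so a weight at most [2 * L] would pass from [y] up to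
   [rho x], which lies in [A']. *)
have far_A' x y : A' x -> ~ E 2 x -> restr A b x y -> A' y.
  move=> A'x nE [Ax Ay xy]; split=> // Wy.
  have [Mx _] := rhoA' _ A'x; have [[Arx nWrx] _] := Mx.
  case: (nest_bmeet N _ _ _ (below _ A'x nE) xy) => [yr|yr|yr].
  - by apply: nWrx; rewrite -yr.
  - apply: nE; exists (rho x) => //; exists y; first by right.
    exact: reach1.
  - by apply: nWrx; case: wW => _ _ /(_ _ _ _ Ay Arx yr); apply.
(* A maximal member above [u] is also above its neighbour [v], unless [v] equals or [b]-meets it and
   so is near [M]. *)
have far_rho x y : A' x -> ~ E 2 x -> ~ E 2 y -> restr A b x y -> rho y = rho x.
  move=> A'x nEx nEy xy; have A'y := far_A' _ _ A'x nEx xy.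
  have up u v : A' u -> A' v -> restr A b u v -> ~ E 2 v ->
      forall t, M t -> lt u t -> lt v t.
    move=> A'u A'v [Au Av uv] nEv t Mt ut.
    case: (nest_bmeet N _ _ _ ut uv) => // vt; case: nEv; exists t => //.
      by rewrite vt; exact: reach_refl.
    apply: (@reach_leq _ _ 1) => //; apply: reach1; split=> //.
    exact/A'A/MA'.
  apply: rhoE => //; try exact: nEnM.
  by move=> t Mt; split; apply: up => //; exact: bsym.
pose B s := [set x | [/\ A' x, ~ E 2 x & rho x = s]].
(* A path of [k] steps from distance more than [k + 2] never comes within 2 of [M], so its dominator
   never changes. *)
have far_reach k x y : A' x -> ~ E (k + 2)%N x -> reach (restr A b) k x y ->
    B (rho x) y /\ reach (restr (B (rho x)) b) k x y.
  elim: k x => [|k IHk] x A'x nE; first by move=> /= <-.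
  have nEx : ~ E 2 x by move=> /(Eleq _ (k.+1 + 2)%N); move/(_ ltac:(lia))/nE.
  move=> [z [<-|xz] zy].
    have [|Bxy xy] := IHk x A'x _ zy.
      by move=> /(Eleq _ (k.+1 + 2)%N); move/(_ ltac:(lia))/nE.
    by split => //; exists x => //; left.
  have nEz : ~ E (k + 2)%N z.
    move=> /(Ereach _ _ _ _ (reach1 _ _ _ (bsym _ _ xz))).
    by rewrite addn1 -addSn => /nE.
  have nEz2 : ~ E 2 z by move=> /(Eleq _ (k + 2)%N); move/(_ ltac:(lia))/nEz.
  have A'z := far_A' _ _ A'x nEx xz.
  have rz := far_rho _ _ A'x nEx nEz2 xz.
  have := IHk _ A'z nEz zy; rewrite rz => -[Bxy zyB]; split=> //.
  by exists z => //; right; split => //; case: xz.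
have [cM cMP] := meet_colorable M.
have /choice[cB cBP] : forall s, exists c, M s ->
    weighted_coloring (B s) E (cM s) c.
  move=> s; have [Ms|nMs] := pselect (M s); last by exists (fun=> i).
  have BA' : B s `<=` A' by move=> x [].
  have [||||c cP] := IH (B s) s _ _ _ E (cM s).
  - by move=> x /BA' /A'A.
  - exact/A'A/MA'.
  - by move=> [_ /nEnM].
  - apply: weight_dist; first by move=> x /BA' /A'A.
    by move=> u v Mu /BA'; exact: Mmax.
  by exists c.
(* The switch at distance 2 is invisible: up to distance [L] the recursive colouring still equals
   [cM (rho x)]. *)
pose c x := if pselect (W L x) then i else
            if pselect (W (2 * L)%N x) then alt i else
            if pselect (E 2 x) then cM (rho x) else cB (rho x) x.
have cA' x : A' x -> c x = if pselect (E 2 x) then cM (rho x) else cB (rho x) x.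
  move=> [_ nW]; rewrite /c; case: pselect => /= [|_].
    by move=> /(Wleq _ (2 * L)%N); move/(_ ltac:(lia))/nW.
  by case: pselect.
have cfar x : A' x -> ~ E 2 x -> c x = cB (rho x) x.
  by move=> A'x nE; rewrite cA'//; case: pselect.
have cnear x : A' x -> E L x -> c x = cM (rho x).
  move=> A'x Ex; rewrite cA'//; case: pselect => // nE.
  have [Mx _] := rhoA' _ A'x; have [cB1 _ _] := cBP _ Mx.
  exact: cB1.
exists c; split.
- by move=> x Ax Wx; rewrite /c; case: pselect.
- by move=> x Ax nWx Wx; rewrite /c; case: pselect => //= _; case: pselect.
move=> n x y Ax xy; pose deep u := A' u /\ ~ E L u.
(* A chain with a member at depth more than [L] cannot cross the barrier of the
   child it is in, so all of it is bounded by induction. *)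
have deep_step u v : deep u -> outer_step A W c u v ->
    [/\ deep v, rho v = rho u & outer_step (B (rho u)) E (cB (rho u)) u v].
  move=> [A'u nEu] [Au Av nWu nWv [cuv uv]].
  have nE k : (k <= L)%N -> ~ E k u by move=> kL /(Eleq _ _ _ kL).
  have nE2u : ~ E 2 u by apply: nE; lia.
  have [[A'v nE2v rv] uvB] := far_reach _ _ _ A'u (nE (r + 2)%N ltac:(lia)) uv.
  have [Mu _] := rhoA' _ A'u; have [cB1 cB2 _] := cBP _ Mu.
  have cuv' : cB (rho u) u = cB (rho u) v.
    by rewrite -(cfar u)// cuv cfar// rv.
  (* Otherwise [v] has colour [cM (rho u)], while [u], between [L] and [2 * L], has the barrier
     colour. *)
  have nEv : ~ E L v.
    move=> Ev; apply: (altP (cM (rho u))); rewrite -(cB2 u)//.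
      by rewrite cuv' cB1.
    have /Ereach/(_ Ev) := reach_sym _ bsym _ _ _ uv.
    by apply: Eleq; lia.
  by split=> //; split.
have deep_reach m u v : deep u -> reach (outer_step A W c) m u v ->
    [/\ deep v, rho v = rho u &
        reach (outer_step (B (rho u)) E (cB (rho u))) m u v].
  elim: m u => [|m IHm] u du; first by move=> /= <-.
  move=> [z [<-|uz] zv].
    by have [dv rv uv] := IHm u du zv; split=> //; exists u => //; left.
  have [dz rz uzB] := deep_step _ _ du uz.
  have [dv rv] := IHm z dz zv; rewrite rz => zvB.
  by split=> //; [rewrite rv|exists z => //; right].
have [dx|ndx] := pselect (deep x).
  have [[A'y nEy] ry xyB] := deep_reach _ _ _ dx xy; have [A'x nEx] := dx.
  have [Mx _] := rhoA' _ A'x; have [_ _ cB3] := cBP _ Mx.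
  left; case: (cB3 n x y _ xyB) => [|xy'|[Ex Ey]].
  - by split=> // /(Eleq _ L); move/(_ ltac:(lia)).
  - by apply: reach_sub xy' => u v [[/A'A Au _ _] [/A'A Av _ _]].
  - apply: (reach_leq _ (D1.+1 + D1.+1)); first by lia.
    apply: reach_trans (E_rho _ _ A'x Ex) _; rewrite -ry.
    by apply: reach_sym => //; exact: E_rho.
(* Otherwise the retraction bounds the chain, up to the first time it comes so
   close to the part coloured earlier that an [r]-step may leave [A']; from
   there on the bound is on the weight. *)
pose touch u := W (2 * L + r)%N u.
pose free_step u v := [/\ outer_step A W c u v, ~ touch u & ~ touch v].
have inA' k u v : A u -> ~ W (2 * L + k)%N u -> reach (restr A b) k u v ->
    reach (restr A' b) k u v.
  elim: k u => [//|k IHk] u Au nWu [z [<-|uz] zv].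
    exists u; first by left.
    by apply: IHk => // /(Wleq _ (2 * L + k.+1)%N); move/(_ ltac:(lia)).
  have nWz : ~ W (2 * L + k)%N z.
    move=> /(Wreach _ _ _ _ (reach1 _ _ _ (bsym _ _ uz))).
    by rewrite addn1 -addnS.
  have [_ Az uzb] := uz; exists z; last exact: IHk.
  right; split=> //; split=> //.
    by move=> /(Wleq _ (2 * L + k.+1)%N); move/(_ ltac:(lia)).
  by move=> /(Wleq _ (2 * L + k)%N); move/(_ ltac:(lia)).
have rho_reach k u v : reach (restr A' b) k u v ->
    reach (restr M a) k (rho u) (rho v).
  apply: reach_map => {}u {}v [A'u A'v /(bmeet_meet N) uv].
  have [Mu uru] := rhoA' _ A'u; have [Mv vrv] := rhoA' _ A'v.
  by have [|] := meet_above N _ _ _ _ uru vrv uv; [left|right].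
have free_A' u : A u -> ~ touch u -> A' u.
  by move=> Au nt; split=> // /(Wleq _ (2 * L + r)%N); move/(_ ltac:(lia)).
have near u : A' u -> ~ deep u -> E L u.
  by move=> A'u nd; apply: contrapT => nE; exact: nd.
have deepN u v : ~ deep u -> outer_step A W c u v -> ~ deep v.
  by move=> nd /outer_step_sym vu dv; case: (deep_step _ _ dv vu).
(* All members of such a chain are within [L] of [M], so their dominators form a chain monochromatic
   for [cM]. *)
have free_reach m u v : A' u -> ~ deep u -> reach free_step m u v ->
    reach (restr A b) D0 u v.
  move=> A'u nd uv.
  have [A'v ndv ruv] : [/\ A' v, ~ deep v &
      reach (mono_step (restr M a) r cM) m (rho u) (rho v)].
    elim: m u A'u nd uv => [|m IHm] u A'u nd; first by move=> /= <-.
    move=> [z [<-|[uz ntu ntz]] zv].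
      have [A'v ndv uv] := IHm u A'u nd zv.
      by split=> //; exists (rho u) => //; left.
    have [Au Az _ _ [cuz uzb]] := uz.
    have A'z := free_A' _ Az ntz; have ndz := deepN _ _ nd uz.
    have [A'v ndv zvM] := IHm z A'z ndz zv.
    split=> //; exists (rho z) => //; right; split; last exact/rho_reach/inA'.
    by rewrite -!cnear//; exact: near.
  have toA p q : reach (restr M a) Df p q -> reach (restr A b) Df p q.
    apply: reach_sub => s t [Ms Mt st].
    split; [exact/A'A/MA'|exact/A'A/MA'|exact: (maxl_meet N _ _ _ Ms Mt st)].
  apply: (reach_leq _ (L.+1 + (Df + L.+1))); first by lia.
  apply: reach_trans (E_rho _ _ A'u (near _ A'u nd)) _.
  apply: reach_trans (toA _ _ (cMP _ _ _ ruv)) _.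
  by apply: reach_sym => //; apply: E_rho => //; exact: near.
have first_touch m u v : reach (outer_step A W c) m u v ->
    [\/ touch u, reach free_step m u v |
        exists z z',
          [/\ reach free_step m u z, outer_step A W c z z' & touch z']].
  elim: m u => [|m IHm] u; first by constructor 2.
  move=> [w uw wv]; have [tu|ntu] := pselect (touch u); first by constructor 1.
  have [tw|ntw] := pselect (touch w).
    case: uw => [uw|uw]; first by case: ntu; rewrite uw.
    by constructor 3; exists u, w; split=> //; exact: reach_refl.
  have uw' : u = w \/ free_step u w by case: uw; [left|right].
  case: (IHm _ wv) => [//|wv'|[z [z' [wz zz' tz']]]].
    by constructor 2; exists w.
  by constructor 3; exists z, z'; split=> //; exists w.
have bound m u v : A u -> ~ deep u -> reach (outer_step A W c) m u v ->
    W D1 u \/ reach (restr A b) D0 u v.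
  move=> Au nd uv; have [tu|ntu] := pselect (touch u).
    by left; apply: Wleq tu; lia.
  have A'u := free_A' _ Au ntu.
  case: (first_touch _ _ _ uv) => [//|uv'|[z [z' [uz zz' tz']]]].
    by right; exact: free_reach uv'.
  (* Going back from the touching member [z'] to [u] costs [r + D0] beyond its weight
     [2 * L + r]. *)
  left; have [_ _ _ _ [_ zz'b]] := zz'.
  have zu := reach_trans _ _ _ _ _ _ (reach_sym _ bsym _ _ _ zz'b)
    (reach_sym _ bsym _ _ _ (free_reach _ _ _ A'u nd uz)).
  by apply: Wleq (Wreach _ _ _ _ zu tz'); lia.
have yx := reach_sym _ (outer_step_sym A W c) _ _ _ xy.
have Ay : A y.
  elim: n x xy Ax {ndx yx} => [x <- //|n IHn x [z xz zy] Ax].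
  by apply: IHn zy _; case: xz => [<-|[]].
have ndy : ~ deep y.
  by move=> dy; have [] := deep_reach _ _ _ dy yx.
(* A weight bound is needed at both ends, so the chain is also run backwards from [y]. *)
case: (bound _ _ _ Ax ndx xy) => [Wx|xy']; last first.
  by left; apply: reach_leq xy'; lia.
case: (bound _ _ _ Ay ndy yx) => [Wy|yx']; first by right.
by left; apply: reach_leq (reach_sym _ bsym _ _ _ yx'); lia.
Qed.

End WeightedColoring.

Lemma colorable_nest_bmeet {I C : Type} {a b lt : I -> I -> Prop}
    (N : nesting a b lt) (i : C) (alt : C -> C) r D (A : set I) :
  (forall j, alt j <> j) -> listed A ->
  (forall M, colorable C (restr M a) r D) ->
  colorable C (restr A b) r (2 * (D + 6 * r + 15)).
Proof.
move=> altP Al Mcol.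
(* Under the empty weight nothing has been coloured earlier, and the weight alternative of the bound
   is impossible. *)
have W0 : weight (b:=b) (lt:=lt) A (fun=> set0) by split.
have [||||c [_ _ cP]] := weighted_coloring_ex N (L := (r + 3)%N) (Df := D)
  (D0 := (D + 2 * (r + 4))%N) (D1 := (D + 6 * r + 14)%N)
  (D := (2 * (D + 6 * r + 15))%N) altP Mcol _ _ _ _ A Al _ i W0; try lia.
exists c => n x y xy.
have [Ax|nAx] := pselect (A x); last first.
  suff -> : x = y by exact: reach_refl.
  elim: n x xy nAx => [//|n IHn] x [z xz zy] nAx.
  have xz' : x = z.
    by case: xz => // -[_ xz]; case: (reach_restr _ _ _ _ _ xz) => // -[].
  by rewrite xz' in nAx *; exact: IHn.
have xy' :
    reach (outer_step (b:=b) (r:=r) (L:=(r + 3)%N) A (fun=> set0) c) n x y.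
  elim: n x xy Ax => [//|n IHn] x [z xz zy] Ax.
  have Az : A z.
    case: (xz) => [<-//|[_ xz']].
    by case: (reach_restr _ _ _ _ _ xz') => [<-|[]].
  exists z; last exact: IHn.
  by case: xz => [->|xz]; [left|right; split].
by case: (cP n x y Ax xy') => // -[].
Qed.

Lemma restr_restr {V : Type} (A B : set V) (E : V -> V -> Prop) :
  restr A (restr B E) = restr (A `&` B) E.
Proof.
apply/funext => x; apply/funext => y; apply/propext.
by split=> [[Ax Ay [Bx By xy]]|[[Ax Bx] [Ay By] xy]].
Qed.

(** * The topology: members that meet have meeting boundaries or are nested *)

Section ClosedConnected.
Context {T : topologicalType} {I : Type} (F : I -> set T).
Context (connT : connected [set: T])
  (hF : forall i, [/\ closed (F i), F i !=set0, connected (F i),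
                      boundary (F i) !=set0 & connected (boundary (F i))])
  (hcov : forall x y, F x `|` F y <> [set: T]).

(** Missing the boundary makes the trace of [B] on [A] both open and closed in [A]. *)
Lemma connected_closed_int (A B : set T) : connected A -> closed B ->
  A `&` boundary B = set0 -> A `&` B !=set0 -> A `<=` B°.
Proof.
move=> Aconn Bcl AB0 ABn0; apply/setIidPl.
have BE : A `&` B = A `&` B°.
  apply/seteqP; split=> p [Ap Bp]; split=> //; last exact: interior_subset Bp.
  apply: contrapT => nBp; have : (A `&` boundary B) p.
    by split=> //; split=> //; exact: subset_closure.
  by rewrite AB0.
rewrite -BE; apply: Aconn => //; last by exists B.
by exists B° => //; exact: open_interior.
Qed.

Lemma closed_int_boundary (B : set T) : closed B -> B `<=` B° `|` boundary B.
Proof.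
move=> Bcl p Bp; have [|nBp] := pselect (B° p); [by left|right].
by split=> //; exact: subset_closure.
Qed.

Lemma boundary_subset (B : set T) : closed B -> boundary B `<=` B.
Proof. by move=> /closure_id {2}-> p []. Qed.

(** If all three cases fail, each boundary lies in the interior of the other member; the union is
    then open and closed, hence all of [T], against [hcov]. *)
Lemma meet_boundary_cases x y : F x `&` F y !=set0 ->
  [\/ boundary (F x) `&` boundary (F y) !=set0,
      F x `<=` (F y)° | F y `<=` (F x)°].
Proof.
move=> xy.
have [clx _ conx _ conbx] := hF x; have [cly _ cony _ conby] := hF y.
have [bxy|/set0P bxy] := eqVneq (boundary (F x) `&` boundary (F y)) set0;
  last by constructor 1.
have [bxFy|/set0P bxFy] := eqVneq (boundary (F x) `&` F y) set0.
  by constructor 3; apply: connected_closed_int => //; rewrite setIC.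
have [byFx|/set0P byFx] := eqVneq (boundary (F y) `&` F x) set0.
  by constructor 2; apply: connected_closed_int => //; rewrite setIC.
have bx := connected_closed_int _ _ conbx cly bxy bxFy.
have byx : boundary (F y) `&` boundary (F x) = set0 by rewrite setIC.
have by_ := connected_closed_int _ _ conby clx byx byFx.
have UE : F x `|` F y = (F x)° `|` (F y)°.
  apply/seteqP; split=> p.
    case=> [/(closed_int_boundary _ clx)|/(closed_int_boundary _ cly)].
      by case=> [|/bx]; [left|right].
    by case=> [|/by_]; [right|left].
  by case=> /interior_subset; [left|right].
case: (@hcov x y); apply: connT.
- by case: xy => p [xp _]; exists p; left.
- exists (F x `|` F y); last by rewrite setTI.
  by rewrite UE; apply: openU; exact: open_interior.
- by exists (F x `|` F y); [exact: closedU | rewrite setTI].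
Qed.

Lemma family_nesting :
  nesting (int_adj F) (int_adj (fun i => boundary (F i)))
    (fun x y => F x `<=` (F y)°).
Proof.
(* A closed set contains its boundary, and a boundary point is not interior. *)
have irr x : ~ F x `<=` (F x)°.
  have [cl _ _ [p bp] _] := hF x => sub.
  by have [_] := bp; apply; apply: sub; exact: boundary_subset bp.
split=> //.
- exact: int_adj_sym.
- exact: int_adj_sym.
- move=> x y [xy [p [px py]]]; split=> //; exists p.
  have [clx _ _ _ _] := hF x; have [cly _ _ _ _] := hF y.
  by split; apply: boundary_subset.
- move=> x y xy; split; first by move=> eqxy; apply: (irr x); rewrite {2}eqxy.
  have [_ [p xp] _ _ _] := hF x; exists p; split=> //.
  apply: interior_subset; exact: xy.
- by move=> x y z xy yz p /xy /interior_subset /yz.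
- move=> x y [_ [p [px [_ npy]]]] sub; apply: npy; apply: sub.
  by have [clx _ _ _ _] := hF x; exact: boundary_subset px.
- move=> x y z xy [_ [p [xp zp]]].
  have [|nyz] := pselect (y = z); first by left.
  by right; split=> //; exists p; split=> //; apply: interior_subset; exact: xy.
- move=> x y [nxy /meet_boundary_cases[bxy|xy|yx]];
    [by constructor 1|by constructor 2|by constructor 3].
Qed.

End ClosedConnected.

(** * The two inequalities *)

Local Open Scope ring_scope.

Theorem theorem1p7 (R : realType) (T : topologicalType)
    (connT : connected [set: T]) (I : Type) (F : I -> set T)
    (hF : forall i, [/\ closed (F i), F i !=set0, connected (F i),
                        boundary (F i) !=set0 & connected (boundary (F i))])
    (hcov : forall J : set I, finite_set J ->
              \bigcup_(i in J) F i <> [set: T]) :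
  (int_asdim R F <= int_asdim R (fun i => boundary (F i)))%E /\
  (int_asdim R (fun i => boundary (F i)) <= maxe (int_asdim R F) 1)%E.
Proof.
have hcov2 x y : F x `|` F y <> [set: T].
  have := hcov [set x; y] (finite_set2 x y).
  by rewrite bigcup_setU !bigcup_set1.
have N := family_nesting _ connT hF hcov2.
have listedI (l : seq I) J : listed ((fun x => List.In x l) `&` J).
  by exists l => x [].
have part1 m : asdim_le R (fun G => exists J : set I, G = int_graph
      (@subfamily T I (fun i => boundary (F i)) J)) m ->
    asdim_le R (fun G => exists J : set I, G = int_graph
      (@subfamily T I F J)) m.
  move=> /asdim_le_colorable bcol; apply/asdim_le_colorable => r r0.
  have [D DP] := bcol r r0; exists (D + 2)%N => J.
  apply: colorable_compact => l; rewrite restr_restr.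
  exact: (colorable_nest_meet N).
have part2 m : asdim_le R (fun G => exists J : set I, G = int_graph
      (@subfamily T I F J)) m ->
    asdim_le R (fun G => exists J : set I, G = int_graph
      (@subfamily T I (fun i => boundary (F i)) J)) (maxn m 1).
  move=> /asdim_le_colorable col; apply/asdim_le_colorable => r r0.
  have [D DP] := col r r0; exists (2 * (D + 6 * r + 15))%N => J.
  apply: colorable_compact => l; rewrite restr_restr.
  have mlt : (m.+1 <= (maxn m 1).+1)%N by rewrite ltnS leq_maxl.
  (* A map without fixed points needs two colours, which [maxn m 1] provides. *)
  pose alt (i : 'I_(maxn m 1).+1) : 'I_(maxn m 1).+1 :=
    if i == ord0 then ord_max else ord0.
  apply: (colorable_nest_bmeet N ord0 alt) => //.
    move=> i; rewrite /alt; have [->|/eqP/nesym//] := eqVneq i ord0.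
    by move=> /(congr1 val) /=; lia.
  move=> M; apply: (sub_colorable _ _ (widen_ord mlt)) (DP M).
  by move=> u v /(congr1 val) /= /val_inj.
split.
  by apply: ereal_inf_le_tmp => _ [m /part1 mP <-]; exists m.
rewrite /int_asdim {1}/asdim.
(* If the dimension for the boundaries exceeds 1, the bound [maxn m 1] can only be [m]. *)
have [b1|b1] := leP (asdim R (fun G => exists J : set I, G = int_graph
      (@subfamily T I (fun i => boundary (F i)) J))) 1%E.
  by apply: le_trans b1 _; rewrite le_max lexx orbT.
rewrite le_max; apply/orP; left; apply: le_ereal_inf_tmp => _ [m mP <-].
have : (asdim R (fun G => exists J : set I, G = int_graph
      (@subfamily T I (fun i => boundary (F i)) J)) <= (maxn m 1)%:R%:E)%E.
  by apply: ereal_inf_lbound; exists (maxn m 1) => //; exact: part2.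
case: leqP => // _.
by move=> /(lt_le_trans b1); rewrite ltxx.
Qed.
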